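(* Let $(L,[,],\alpha)$ be a multiplicative Hom-Lie algebra. Then $$L_T=(L,\ [,,]=[,]\circ([,]\otimes\alpha),\ \alpha^2)$$ (with triple product $[xyz]=[[x,y],\alpha(z)]$ and both twisting maps equal to $\alpha^2=\alpha\circ\alpha$) is a multiplicative Hom-Lie triple system.
   Context: We work over a fixed field $\mathbf{k}$ of characteristic $0$. A Hom-Lie algebra $(L,[,],\alpha)$ is a $\mathbf{k}$-module $L$ with an anti-symmetric bilinear map $[,]\colon L^{\otimes 2}\to L$ and a linear map $\alpha\colon L\to L$ such that $[[x,y],\alpha(z)]+[[z,x],\alpha(y)]+[[y,z],\alpha(x)]=0$ for all $x,y,z\in L$. It is multiplicative if $\alpha([x,y])=[\alpha(x),\alpha(y)]$ for all $x,y$. A Hom-Lie triple system $(V,[,,],(\alpha_1,\alpha_2))$ is a $\mathbf{k}$-module $V$ with a trilinear map $[,,]\colon V^{\otimes 3}\to V$ and linear maps $\alpha_1,\alpha_2\colon V\to V$ (twisting maps) such that $[uvw]=-[vuw]$, $[uvw]+[wuv]+[vwu]=0$, and $$[\alpha_1(x)\alpha_2(y)[uvw]]=[[xyu]\alpha_1(v)\alpha_2(w)]+[\alpha_1(u)[xyv]\alpha_2(w)]+[\alpha_1(u)\alpha_2(v)[xyw]]$$ for all $u,v,w,x,y\in V$. It is multiplicative if $\alpha_1=\alpha_2$ and this common map $\gamma$ satisfies $\gamma([xyz])=[\gamma(x)\gamma(y)\gamma(z)]$ for all $x,y,z$. When the twisting maps are equal only the common value is written. *)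

(* Defs.v *)
From mathcomp Require Import all_boot all_order all_algebra.

Set Implicit Arguments.
Unset Strict Implicit.
Unset Printing Implicit Defensive.

Import GRing.Theory.
Local Open Scope ring_scope.

Section HomAlgebras.
Variables (k : fieldType) (V : lmodType k).

Record hom_lie_algebra (br : V -> V -> V) (alpha : V -> V) : Prop := {
  hom_lie_bilinear : bilinear_for *:%R *:%R br;
  hom_lie_twist_linear : linear alpha;
  hom_lie_antisym : forall x y, br x y = - br y x;
  hom_lie_jacobi : forall x y z,
    br (br x y) (alpha z) + br (br z x) (alpha y) + br (br y z) (alpha x) = 0
}.

Record multiplicative_hom_lie_algebra (br : V -> V -> V) (alpha : V -> V)
    : Prop := {
  mult_hom_lie_base : hom_lie_algebra br alpha;
  mult_hom_lie_morph : forall x y, alpha (br x y) = br (alpha x) (alpha y)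
}.

Record trilinear (t : V -> V -> V -> V) : Prop := {
  trilinear1 : forall v w, linear (fun u => t u v w);
  trilinear2 : forall u w, linear (fun v => t u v w);
  trilinear3 : forall u v, linear (fun w => t u v w)
}.

Record hom_lie_triple_system (t : V -> V -> V -> V) (alpha1 alpha2 : V -> V)
    : Prop := {
  hom_lts_trilinear : trilinear t;
  hom_lts_twist1_linear : linear alpha1;
  hom_lts_twist2_linear : linear alpha2;
  hom_lts_antisym : forall u v w, t u v w = - t v u w;
  hom_lts_cyclic : forall u v w, t u v w + t w u v + t v w u = 0;
  hom_lts_nambu : forall u v w x y,
    t (alpha1 x) (alpha2 y) (t u v w)
    = t (t x y u) (alpha1 v) (alpha2 w)
      + t (alpha1 u) (t x y v) (alpha2 w)
      + t (alpha1 u) (alpha2 v) (t x y w)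
}.

Record multiplicative_hom_lie_triple_system
    (t : V -> V -> V -> V) (alpha1 alpha2 : V -> V) : Prop := {
  mult_hom_lts_base : hom_lie_triple_system t alpha1 alpha2;
  mult_hom_lts_twist_eq : alpha1 =1 alpha2;
  mult_hom_lts_morph : forall x y z,
    alpha1 (t x y z) = t (alpha1 x) (alpha1 y) (alpha1 z)
}.

Definition hom_lie_triple_product (br : V -> V -> V) (alpha : V -> V)
  : V -> V -> V -> V := fun x y z => br (br x y) (alpha z).

End HomAlgebras.

(* Main.v *)
(** Writing the Hom-Jacobi identity as the twisted Leibniz rule
    [a p, [q, r]] = [[p, q], a r] + [a q, [p, r]] (with a = alpha), the ternary
    identity with X = [x, y] is obtained by applying the rule twice: first to
    p = a X, q = a [u, v], r = a^2 w, then to p = X, q = a u, r = a v. *)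
Require Import Defs.
From mathcomp Require Import all_boot all_order all_algebra.

Import GRing.Theory.
Local Open Scope ring_scope.

Lemma hom_lie_leibniz (k : fieldType) (L : lmodType k)
    (br : L -> L -> L) (alpha : L -> L) (HL : hom_lie_algebra br alpha)
    (p q r : L) :
  br (alpha p) (br q r) = br (br p q) (alpha r) + br (alpha q) (br p r).
Proof.
case: HL => [[_ linr] _ anti jac].
have brN x y : br x (- y) = - br x y.
  have br0 : br x 0 = 0.
    by have := linr x (-1) 0 0; rewrite /= scaler0 addr0 scaleN1r addNr.
  by have := linr x (-1) y 0; rewrite /= br0 !addr0 !scaleN1r.
(* Antisymmetry brings every term to the shape [br (br _ _) (alpha _)], with the signs of
   [jac p q r]. *)
rewrite (anti (alpha p)) (anti p r) brN -(anti (br r p)).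
by apply/eqP; rewrite eq_sym -addr_eq0 jac.
Qed.

Theorem theorem4p7 (k : fieldType) (char0 : [pchar k] =i pred0)
    (L : lmodType k) (br : L -> L -> L) (alpha : L -> L)
    (HL : multiplicative_hom_lie_algebra br alpha) :
  multiplicative_hom_lie_triple_system
    (hom_lie_triple_product br alpha) (alpha \o alpha) (alpha \o alpha).
Proof.
case: HL => base morph; have leib := hom_lie_leibniz _ _ _ _ base.
case: base => [[linl linr] lina anti jac].
have lin2 : linear (alpha \o alpha) by move=> c x y /=; rewrite !lina.
have brNl x y : br (- x) y = - br x y.
  have br0 : br 0 y = 0.
    by have := linl y (-1) 0 0; rewrite /= scaler0 addr0 scaleN1r addNr.
  by have := linl y (-1) x 0; rewrite /= br0 !addr0 !scaleN1r.
have brDl x y z : br (x + y) z = br x z + br y z.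
  by have := linl z 1 x y; rewrite /= !scale1r.
rewrite /hom_lie_triple_product; split=> //; last first.
  by move=> x y z /=; rewrite !morph.
(* The cyclic identity closes here: it is [jac] verbatim. *)
split=> //.
- split=> [v w|u w|u v] c x y /=.
  + by rewrite (linl v) (linl (alpha w)).
  + by rewrite (linr u) (linl (alpha w)).
  + by rewrite lina (linr (br u v)).
- by move=> u v w; rewrite (anti u v) brNl.
- move=> u v w x y /=.
  (* [leib] needs an outer [alpha] on its left argument. *)
  have -> : br (alpha (alpha x)) (alpha (alpha y)) = alpha (alpha (br x y)).
    by rewrite !morph.
  (* [brDl] splits the first summand; pushing every [alpha] inwards makes both sides coincide. *)
  by rewrite (morph (br u v)) leib (morph u v) leib brDl !morph.
Qed.
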